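(* For any two finite pseudo-metric spaces $(X,d_X)$ and $(Y,d_Y)$ of the same cardinality, \[ d_{IL}\bigl(\mathcal{PHZ}(X),\mathcal{PHZ}(Y)\bigr)\le 2\,d'_{GH}(X,Y), \] where $\mathcal{PHZ}$ is the bigraded persistent homology module, $d_{IL}$ is the interleaving distance and $d'_{GH}$ is the modified Gromov--Hausdorff distance.
   Context: Throughout, $\mathbf k$ is a principal ideal domain and homology has coefficients in $\mathbf k$. **Finite pseudo-metric spaces.** A finite pseudo-metric space is a nonempty finite set $X$ with $d_X\colon X\times X\to\mathbb R_{\ge0}$ satisfying $d_X(x,x)=0$, symmetry and the triangle inequality (distinct points may be at distance $0$). **Vietoris--Rips complex.** $R(X,t)$ ($t\ge 0$) is the clique complex of the graph with vertex set $X$ in which $x\neq y$ are joined by an edge iff $d_X(x,y)\le t$. For $t_1\le t_2$ there is an inclusion $R(X,t_1)\subset R(X,t_2)$. **Bigraded homology.** Let $K$ be a simplicial complex on a finite vertex set $V$, $|V|=m$ (with $\varnothing\in K$ and all $\{v\}\in K$). For $J\subset V$, $K_J$ is the full subcomplex of $K$ on $J$. The bigraded homology of the moment-angle complex $\mathcal Z_K$ is (Hochster decomposition) \[ H_{-i,2j}(\mathcal Z_K)=\bigoplus_{J\subset V,\ |J|=j}\widetilde H_{j-i-1}(K_J), \] where $\widetilde H_*$ is reduced simplicial homology, with $\widetilde H_{-1}(\varnothing)=\mathbf k$ for the empty complex. An inclusion $K\subset L$ of complexes on the same $V$ induces the direct sum of the maps $\widetilde H_*(K_J)\to\widetilde H_*(L_J)$.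 **Persistence modules.** A persistence module is a functor $\mathcal M$ from the poset $(\mathbb R_{\ge0},\le)$ to $\mathbf k$-modules. Direct sums are pointwise. For a finite pseudo-metric space $X$ with $|X|=m$, $\mathcal{PHZ}_{-i,2j}(X)$ is the persistence module $t\mapsto H_{-i,2j}(\mathcal Z_{R(X,t)})$ with maps induced by inclusions $R(X,t_1)\subset R(X,t_2)$, and $\mathcal{PHZ}(X)=\bigoplus_{0\le i\le m-1,\ 0\le j\le m}\mathcal{PHZ}_{-i,2j}(X)$. **Interleaving distance.** For $\epsilon\ge0$, $\mathcal M^\epsilon(s)=\mathcal M(s+\epsilon)$, with correspondingly shifted maps, and $\eta^\epsilon_{\mathcal M}\colon\mathcal M\to\mathcal M^\epsilon$ is given by the structure maps $\mathcal M(s)\to\mathcal M(s+\epsilon)$. $\mathcal M,\mathcal N$ are $\epsilon$-interleaved if there are natural transformations $\beta\colon\mathcal M\to\mathcal N^\epsilon$, $\gamma\colon\mathcal N\to\mathcal M^\epsilon$ with $\beta^\epsilon\circ\gamma=\eta^{2\epsilon}_{\mathcal N}$ and $\gamma^\epsilon\circ\beta=\eta^{2\epsilon}_{\mathcal M}$, where $\beta^\epsilon,\gamma^\epsilon$ are the $\epsilon$-shifts. $d_{IL}(\mathcal M,\mathcal N)=\inf\{\epsilon\ge 0: \mathcal M,\mathcal N\text{ are }\epsilon\text{-interleaved}\}$. **Modified Gromov--Hausdorff distance.** For finite pseudo-metric spaces of the same cardinality, \[ d'_{GH}(X,Y)=\tfrac12\min_{\theta}\max_{x_1,x_2\in X}|d_X(x_1,x_2)-d_Y(\theta(x_1),\theta(x_2))|,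 \] the minimum being over all bijections $\theta\colon X\to Y$. *)

(* Defs.v *)
From HB Require Import structures.
From mathcomp Require Import all_boot all_order all_algebra.
From mathcomp Require Import all_classical all_reals.
From mathcomp Require Import ereal finset.

Set Implicit Arguments.
Unset Strict Implicit.
Unset Printing Implicit Defensive.

Import Order.TTheory GRing.Theory Num.Theory.
Local Open Scope ring_scope.

Definition is_ideal (k : comNzRingType) (I : set k) : Prop :=
  [/\ I 0, forall x y, I x -> I y -> I (x + y) & forall a x, I x -> I (a * x)].

(* Being an integral domain is part of the type [idomainType]. *)
Definition is_pid (k : idomainType) : Prop :=
  forall I : set k, is_ideal I ->
    exists a : k, forall x, I x <-> exists b, x = b * a.

Section QuotientModule.
Variables (k : nzRingType) (V : lmodType k) (I : submodClosed V).

(* [submodClosed] does not inherit from [zmodClosed]. *)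
Definition submod_pred : {pred V} := I.

Fact submod_pred_zmod_closed : zmod_closed submod_pred.
Proof.
split; first exact: (rpred0 I).
by move=> v w vI wI; rewrite -scaleN1r; exact: (rpredD (S := I) vI (rpredZ _ wI)).
Qed.

HB.instance Definition _ :=
  GRing.isZmodClosed.Build V submod_pred submod_pred_zmod_closed.

Definition quotmod : Type := Quotient.quot submod_pred.

HB.instance Definition _ := GRing.Zmodule.on quotmod.

Definition quotmod_pi (v : V) : quotmod := \pi_(Quotient.quot submod_pred)%qT v.

Definition quotmod_repr (x : quotmod) : V := @generic_quotient.repr V (Quotient.quot submod_pred) x.

Lemma quotmod_reprK x : quotmod_pi (quotmod_repr x) = x.
Proof. exact: (@reprK V (Quotient.quot submod_pred)). Qed.

Lemma quotmod_piP (v w : V) :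
  reflect (quotmod_pi v = quotmod_pi w) (v - w \in I).
Proof.
by have -> : (v - w \in I) = (quotmod_pi v == quotmod_pi w);
  [exact: (Quotient.idealrBE submod_pred)|exact: eqP].
Qed.

Lemma quotmod_pi_is_zmod_morphism : zmod_morphism quotmod_pi.
Proof. by move=> v w; rewrite /quotmod_pi raddfB. Qed.

Lemma quotmod_reprB (v : V) : v - quotmod_repr (quotmod_pi v) \in I.
Proof. by apply/quotmod_piP; rewrite quotmod_reprK. Qed.

Definition quotmod_scale (a : k) (x : quotmod) : quotmod :=
  quotmod_pi (a *: quotmod_repr x).

Lemma quotmod_scaleE a v : quotmod_scale a (quotmod_pi v) = quotmod_pi (a *: v).
Proof.
apply/esym/quotmod_piP; rewrite -scalerBr.
exact: (rpredZ a (quotmod_reprB v)).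
Qed.

Lemma quotmod_piD v w : quotmod_pi (v + w) = quotmod_pi v + quotmod_pi w.
Proof. by rewrite /quotmod_pi raddfD. Qed.

Fact quotmod_scalerA a b x :
  quotmod_scale a (quotmod_scale b x) = quotmod_scale (a * b) x.
Proof. by rewrite -[x]quotmod_reprK !quotmod_scaleE scalerA. Qed.

Fact quotmod_scale1r : left_id 1 quotmod_scale.
Proof. by move=> x; rewrite -[x]quotmod_reprK quotmod_scaleE scale1r. Qed.

Fact quotmod_scalerDr : right_distributive quotmod_scale +%R.
Proof.
move=> a x y; rewrite -[x]quotmod_reprK -[y]quotmod_reprK -quotmod_piD.
by rewrite !quotmod_scaleE scalerDr quotmod_piD.
Qed.

Fact quotmod_scalerDl x : {morph quotmod_scale^~ x : a b / a + b}.
Proof.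
move=> a b; rewrite -[x]quotmod_reprK.
by rewrite !quotmod_scaleE scalerDl quotmod_piD.
Qed.

HB.instance Definition _ := GRing.Zmodule_isLmodule.Build k quotmod
  quotmod_scalerA quotmod_scale1r quotmod_scalerDr quotmod_scalerDl.

Lemma quotmod_pi_is_linear : linear quotmod_pi.
Proof. by move=> a v w; rewrite quotmod_piD -quotmod_scaleE. Qed.

HB.instance Definition _ :=
  GRing.isLinear.Build k V quotmod *:%R quotmod_pi quotmod_pi_is_linear.

End QuotientModule.

Section QuotientMap.
Variables (k : nzRingType) (V W : lmodType k).
Variables (I : submodClosed V) (J : submodClosed W) (f : {linear V -> W}).
Hypothesis fIJ : forall v, v \in I -> f v \in J.

Definition quotmod_fun (x : quotmod I) : quotmod J :=
  quotmod_pi J (f (quotmod_repr x)).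

Lemma quotmod_funE v : quotmod_fun (quotmod_pi I v) = quotmod_pi J (f v).
Proof.
apply/esym/quotmod_piP; rewrite -raddfB.
exact: fIJ (quotmod_reprB I v).
Qed.

Lemma quotmod_fun_is_linear : linear quotmod_fun.
Proof.
move=> a x y; rewrite -[x]quotmod_reprK -[y]quotmod_reprK.
by rewrite -linearP !quotmod_funE linearP linearP.
Qed.

Definition quotmod_map : {linear quotmod I -> quotmod J} :=
  HB.pack quotmod_fun
    (GRing.isLinear.Build _ _ _ _ quotmod_fun quotmod_fun_is_linear).

Lemma quotmod_mapE v : quotmod_map (quotmod_pi I v) = quotmod_pi J (f v).
Proof. exact: quotmod_funE. Qed.

End QuotientMap.

Section DirectSum.
Variables (k : nzRingType) (T : finType).

(* As T is finite, the direct sum is the product. *)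
Definition dsum (M : T -> lmodType k) : Type := {dffun forall i : T, M i}.

Section Module.
Variable M : T -> lmodType k.
Implicit Types x y z : dsum M.

HB.instance Definition _ := Choice.on (dsum M).

Definition dsum0 : dsum M := [ffun i => 0 : M i].
Definition dsum_opp x : dsum M := [ffun i => - x i : M i].
Definition dsum_add x y : dsum M := [ffun i => x i + y i : M i].
Definition dsum_scale (a : k) x : dsum M := [ffun i => a *: x i : M i].

Fact dsum_addA : associative dsum_add.
Proof. by move=> x y z; apply/ffunP => i; rewrite !ffunE addrA. Qed.
Fact dsum_addC : commutative dsum_add.
Proof. by move=> x y; apply/ffunP => i; rewrite !ffunE addrC. Qed.
Fact dsum_add0 : left_id dsum0 dsum_add.
Proof. by move=> x; apply/ffunP => i; rewrite !ffunE add0r. Qed.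
Fact dsum_addN : left_inverse dsum0 dsum_opp dsum_add.
Proof. by move=> x; apply/ffunP => i; rewrite !ffunE addNr. Qed.

HB.instance Definition _ :=
  GRing.isZmodule.Build (dsum M) dsum_addA dsum_addC dsum_add0 dsum_addN.

Fact dsum_scalerA a b x : dsum_scale a (dsum_scale b x) = dsum_scale (a * b) x.
Proof. by apply/ffunP => i; rewrite !ffunE scalerA. Qed.
Fact dsum_scale1r : left_id 1 dsum_scale.
Proof. by move=> x; apply/ffunP => i; rewrite !ffunE scale1r. Qed.
Fact dsum_scalerDr : right_distributive dsum_scale +%R.
Proof. by move=> a x y; apply/ffunP => i; rewrite !ffunE scalerDr. Qed.
Fact dsum_scalerDl x : {morph dsum_scale^~ x : a b / a + b}.
Proof. by move=> a b; apply/ffunP => i; rewrite !ffunE scalerDl. Qed.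

HB.instance Definition _ := GRing.Zmodule_isLmodule.Build k (dsum M)
  dsum_scalerA dsum_scale1r dsum_scalerDr dsum_scalerDl.

Lemma dsumDE x y i : (x + y) i = x i + y i. Proof. exact: ffunE. Qed.
Lemma dsumZE a x i : (a *: x) i = a *: x i. Proof. exact: ffunE. Qed.

End Module.

Section Map.
Variables (M N : T -> lmodType k) (f : forall i, {linear M i -> N i}).

Definition dsum_fun (x : dsum M) : dsum N := [ffun i => f i (x i) : N i].

Lemma dsum_fun_is_linear : linear dsum_fun.
Proof.
move=> a x y; apply/ffunP => i.
by rewrite dsumDE dsumZE !ffunE linearP.
Qed.

Definition dsum_map : {linear dsum M -> dsum N} :=
  HB.pack dsum_fun (GRing.isLinear.Build _ _ _ _ dsum_fun dsum_fun_is_linear).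

Lemma dsum_mapE x i : dsum_map x i = f i (x i).
Proof. exact: ffunE. Qed.

End Map.
End DirectSum.

(* Points of V need not be vertices, so that a full subcomplex of K on J
   is again a complex on V. *)
Record scomplex (V : finType) := SComplex {
  faces :> {set {set V}};
  scomplex0 : set0 \in faces;
  scomplexS : forall s t : {set V}, t \subset s -> s \in faces -> t \in faces }.

Section FullSubcomplex.
Variables (V : finType) (K : scomplex V) (J : {set V}).

Definition full_faces : {set {set V}} := [set s in faces K | s \subset J].

Fact full_faces0 : set0 \in full_faces.
Proof. by rewrite inE scomplex0 sub0set. Qed.

Fact full_facesS (s t : {set V}) :
  t \subset s -> s \in full_faces -> t \in full_faces.
Proof.
move=> ts; rewrite !inE => /andP[sK sJ].
by rewrite (scomplexS ts sK) (fintype.subset_trans ts sJ).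
Qed.

Definition full_subcomplex := SComplex full_faces0 full_facesS.

End FullSubcomplex.

Lemma full_subcomplex_mono (V : finType) (K L : scomplex V) (J : {set V}) :
  faces K \subset faces L ->
  faces (full_subcomplex K J) \subset faces (full_subcomplex L J).
Proof.
move=> /fintype.subsetP KL; apply/fintype.subsetP => s.
by rewrite !inE => /andP[/KL -> ->].
Qed.

Section CliqueComplex.
Variables (V : finType) (e : rel V).

Definition clique_faces : {set {set V}} :=
  [set s : {set V} | [forall x in s, forall y in s, (x != y) ==> e x y]].

Fact clique_faces0 : set0 \in clique_faces.
Proof. by rewrite inE; apply/forall_inP => x; rewrite inE. Qed.

Fact clique_facesS (s t : {set V}) :
  t \subset s -> s \in clique_faces -> t \in clique_faces.
Proof.
move=> /fintype.subsetP ts; rewrite !inE => /forall_inP sP.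
apply/forall_inP => x /ts xs; apply/forall_inP => y /ts ys.
by have /forall_inP/(_ y ys) := sP x xs.
Qed.

Definition clique_complex := SComplex clique_faces0 clique_facesS.

Lemma clique_complex_vertex x : [set x]%SET \in faces clique_complex.
Proof.
rewrite inE; apply/forall_inP => y /set1P ->.
by apply/forall_inP => z /set1P ->; rewrite eqxx.
Qed.

End CliqueComplex.

Section Chains.
Variables (k : nzRingType) (V : finType).
Local Notation chains := {ffun {set V} -> k^o}.
Implicit Types (c : chains) (K L : scomplex V) (n : int).

(* The position of v among the vertices of s, for the order of [enum V]. *)
Definition vpos (s : {set V}) (v : V) : nat :=
  #|[set u in s | (enum_rank u < enum_rank v)%N]|.

(* c : {set V} -> k stands for the formal sum of the c(s) s.  The differential
   sends s to the sum over v in s of (-1)^(vpos s v) (s \ v); as it maps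
   {v} to the empty face, it includes the augmentation. *)
Definition bd c : chains :=
  [ffun t => \sum_(s : {set V}) \sum_(v in s | (s :\ v)%SET == t)
               (-1) ^+ vpos s v * c s].

Fact bd_is_linear : linear bd.
Proof.
move=> a c d; apply/ffunP => t; rewrite !ffunE.
rewrite scaler_sumr -big_split /=; apply: eq_bigr => s _.
rewrite scaler_sumr -big_split /=; apply: eq_bigr => v _.
rewrite !ffunE mulrDr; congr (_ + _).
by rewrite /GRing.scale /= !mulrA; congr (_ * _); rewrite commr_sign.
Qed.

HB.instance Definition _ := GRing.isLinear.Build k chains chains *:%R bd bd_is_linear.

(* The n-chains of K: a face with n + 1 vertices has dimension n, and n = -1
   is allowed; there is no chain but 0 when n < -1. *)
Definition chain K n : {pred chains} :=
  [pred c : chains | [forall s, (c s != 0) ==> (s \in faces K) && (#|s|%:Z == n + 1)]].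

Lemma chainP K n c :
  reflect (forall s, c s != 0 -> s \in faces K /\ #|s|%:Z = n + 1)
          (c \in chain K n).
Proof.
apply: (iffP forallP) => H s.
  by move=> cs; have /implyP/(_ cs)/andP[? /eqP] := H s.
by apply/implyP => /H [-> ->]; rewrite eqxx.
Qed.

Fact chain_submod_closed K n : submod_closed (chain K n).
Proof.
split; first by apply/chainP => s; rewrite ffunE eqxx.
move=> a c d /chainP cK /chainP dK; apply/chainP => s; rewrite !ffunE.
have [->|/cK//] := eqVneq (c s) 0; have [->|/dK//] := eqVneq (d s) 0.
by rewrite scaler0 addr0 eqxx.
Qed.

HB.instance Definition _ K n :=
  GRing.isSubmodClosed.Build k chains (chain K n) (chain_submod_closed K n).

Lemma chain_mono K L n c :
  faces K \subset faces L -> c \in chain K n -> c \in chain L n.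
Proof.
move=> /fintype.subsetP KL /chainP cK; apply/chainP => s /cK[sK ->].
by split=> //; exact: KL.
Qed.

Lemma bd_chain K n c : c \in chain K n -> bd c \in chain K (n - 1).
Proof.
move=> /chainP cK; apply/chainP => t; rewrite ffunE.
have [/existsP[s /exists_inP[v vs /andP[/eqP <- cs]]] _|none] :=
    boolP [exists s : {set V}, [exists v in s, ((s :\ v)%SET == t) && (c s != 0)]].
  have [sK sn] := cK s cs; split; first exact: scomplexS (subD1set s v) sK.
  by rewrite subrK -[n](addrK 1) -sn (cardsD1 v s) vs PoszD addrC addKr.
rewrite big1 ?eqxx// => s _; rewrite big1// => v /andP[vs sv].
have [->|cs] := eqVneq (c s) 0; first by rewrite mulr0.
case/negP: none; apply/existsP; exists s; apply/exists_inP; exists v => //.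
by rewrite sv.
Qed.

Lemma vposD1 (s : {set V}) (v w : V) : w \in s ->
  vpos s v = ((enum_rank w < enum_rank v) + vpos (s :\ w)%SET v)%N.
Proof.
move=> ws; rewrite /vpos (cardsD1 w) !inE ws /=; congr (_ + _)%N.
by apply: eq_card => u; rewrite !inE andbA.
Qed.

Lemma bdK c : bd (bd c) = 0.
Proof.
apply/ffunP => u; rewrite !ffunE.
pose G (s : {set V}) (w v : V) : k^o :=
  if [&& w \in s, v \in s, v != w & (s :\ w :\ v)%SET == u] then
    (-1) ^+ vpos (s :\ w)%SET v * ((-1) ^+ vpos s w * c s) else 0.
have Gww s w : G s w w = 0 by rewrite /G eqxx !andbF.
have Gwv s w v : (enum_rank v < enum_rank w)%N -> G s v w = - G s w v.
  move=> vw; rewrite /G eq_sym [(s :\ w :\ v)%SET]setDDl setUC -setDDl andbCA.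
  case: ifP => [/and4P[ws vs _ _]|_]; last by rewrite oppr0.
  rewrite (vposD1 w vs) (vposD1 v ws) vw ltnNge (ltnW vw) /= add0n add1n.
  by rewrite exprS mulN1r mulNr mulrN opprK !mulrA -!exprD addnC.
transitivity (\sum_s \sum_w \sum_v G s w v).
  transitivity (\sum_(t : {set V}) \sum_(s : {set V}) \sum_(w in s | (s :\ w)%SET == t)
      \sum_(v in t | (t :\ v)%SET == u)
        (-1) ^+ vpos t v * ((-1) ^+ vpos s w * c s)).
    apply: eq_bigr => t _; under eq_bigr => v _.
      rewrite ffunE mulr_sumr; under eq_bigr do rewrite mulr_sumr.
      over.
    rewrite exchange_big; apply: eq_bigr => s _ /=.
    by rewrite exchange_big.
  rewrite exchange_big; apply: eq_bigr => s _ /=.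
  under eq_bigr do rewrite big_mkcondr.
  rewrite exchange_big [LHS]big_mkcond /=; apply: eq_bigr => w _.
  case: ifPn => ws; last by rewrite big1// => v _; rewrite /G (negbTE ws).
  rewrite -big_mkcond /= (big_pred1 (s :\ w)%SET) => [|t]; last by rewrite eq_sym.
  rewrite big_mkcond; apply: eq_bigr => v _.
  by rewrite /G ws /= !inE andbA [(v \in s) && _]andbC.
apply: big1 => s _.
have split3 w : \sum_v G s w v =
    \sum_(v | (enum_rank v < enum_rank w)%N) G s w v +
    \sum_(v | (enum_rank w < enum_rank v)%N) G s w v.
  rewrite (bigID (fun v => enum_rank v < enum_rank w)%N) /=; congr (_ + _).
  rewrite big_mkcond [RHS]big_mkcond; apply: eq_bigr => v _.
  rewrite -leqNgt leq_eqVlt; case: eqP => //= /val_inj/enum_rank_inj <-.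
  by rewrite Gww if_same.
under eq_bigr do rewrite split3.
rewrite big_split /= [X in X + _](_ : _ = - \sum_(w : V)
    \sum_(v | (enum_rank w < enum_rank v)%N) G s w v) ?addNr//.
rewrite (exchange_big_dep predT) //= -sumrN; apply: eq_bigr => v _.
by rewrite -sumrN; apply: eq_bigr => w vw; rewrite (Gwv s w v vw) opprK.
Qed.

Definition cycle_pred K n : {pred chains} :=
  [pred c : chains | (c \in chain K n) && (bd c == 0)].

Fact cycle_submod_closed K n : submod_closed (cycle_pred K n).
Proof.
split; first by apply/andP; rewrite raddf0 eqxx; split=> //; exact: rpred0.
move=> a c d /andP[cK /eqP c0] /andP[dK /eqP d0]; apply/andP; split.
  by rewrite rpredD ?rpredZ.
by rewrite bd_is_linear c0 d0 scaler0 addr0.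
Qed.

HB.instance Definition _ K n := GRing.isSubmodClosed.Build k chains
  (cycle_pred K n) (cycle_submod_closed K n).

Record cycles K n := Cycle { cycle_val : chains; _ : cycle_val \in cycle_pred K n }.

HB.instance Definition _ K n := [isSub for @cycle_val K n].
HB.instance Definition _ K n := [Choice of cycles K n by <:].
HB.instance Definition _ K n := [SubChoice_isSubLmodule of cycles K n by <:].

Definition boundaries K n : {pred cycles K n} :=
  [pred z : cycles K n |
     `[< exists2 b : chains, b \in chain K (n + 1) & bd b = cycle_val z >]].

Fact boundaries_submod_closed K n : submod_closed (@boundaries K n).
Proof.
split; first by apply/asboolP; exists 0; [exact: rpred0|rewrite !raddf0].
move=> a y z /asboolP[b bK by_] /asboolP[d dK dz]; apply/asboolP.
exists (a *: b + d); first by rewrite rpredD ?rpredZ.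
by rewrite bd_is_linear by_ dz.
Qed.

HB.instance Definition _ K n := GRing.isSubmodClosed.Build k (cycles K n)
  (@boundaries K n) (@boundaries_submod_closed K n).

Definition homology K n : lmodType k := quotmod (@boundaries K n).

Section Inclusion.
Variables (K L : scomplex V) (n : int) (KL : faces K \subset faces L).

Fact cycle_mono (z : cycles K n) : cycle_val z \in cycle_pred L n.
Proof.
by have /andP[zK z0] := valP z; apply/andP; rewrite (chain_mono KL zK).
Qed.

Definition cycle_fun (z : cycles K n) : cycles L n := Cycle (cycle_mono z).

Fact cycle_fun_is_linear : linear cycle_fun.
Proof. by move=> a y z; apply: val_inj. Qed.

HB.instance Definition _ := GRing.isLinear.Build k _ _ *:%R cycle_fun cycle_fun_is_linear.

Fact cycle_fun_boundaries z :
  z \in @boundaries K n -> cycle_fun z \in @boundaries L n.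
Proof.
move=> /asboolP[b bK bz]; apply/asboolP; exists b => //.
exact: chain_mono bK.
Qed.

Definition homology_map : {linear homology K n -> homology L n} :=
  quotmod_map cycle_fun_boundaries.

End Inclusion.

Lemma homology_map_id K n (h : faces K \subset faces K) x :
  @homology_map K K n h x = x.
Proof.
rewrite -[x]quotmod_reprK; move: (quotmod_repr x) => z.
rewrite quotmod_mapE; congr quotmod_pi.
exact: val_inj.
Qed.

Lemma homology_map_comp K L M n (h1 : faces K \subset faces L)
    (h2 : faces L \subset faces M) (h3 : faces K \subset faces M) x :
  homology_map n h2 (homology_map n h1 x) = homology_map n h3 x.
Proof.
rewrite -[x]quotmod_reprK; move: (quotmod_repr x) => z.
rewrite [homology_map n h1 _]quotmod_mapE 2!quotmod_mapE; congr quotmod_pi.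
exact: val_inj.
Qed.

End Chains.

Section BigradedHomology.
Variables (k : nzRingType) (V : finType).
Implicit Types (K L : scomplex V) (i j : nat).

(* H_{-i,2j}(Z_K), as given by the Hochster decomposition; the degree
   j - i - 1 is an integer subtraction. *)
Definition bihomology K i j : lmodType k :=
  dsum (fun J : {J : {set V} | #|J| == j} =>
    homology k (full_subcomplex K (val J)) (j%:Z - i%:Z - 1)).

Definition bihomology_map K L i j (h : faces K \subset faces L) :
    {linear bihomology K i j -> bihomology L i j} :=
  dsum_map (fun J : {J : {set V} | #|J| == j} =>
    homology_map k (j%:Z - i%:Z - 1) (full_subcomplex_mono (val J) h)).

End BigradedHomology.

Record pmod (R : realType) (k : nzRingType) := PMod {
  pm_obj :> {nonneg R} -> lmodType k;
  pm_map : forall s t : {nonneg R}, s <= t -> {linear pm_obj s -> pm_obj t};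
  pm_map_id : forall s (h : s <= s) x, pm_map h x = x;
  pm_map_comp : forall s t u (hst : s <= t) (htu : t <= u) (hsu : s <= u) x,
    pm_map htu (pm_map hst x) = pm_map hsu x }.

Section PersistenceModules.
Variables (R : realType) (k : nzRingType).
Implicit Types (M N : pmod R k) (s t e : {nonneg R}).

Section DirectSum.
Variables (T : finType) (M : T -> pmod R k).

Definition pm_dsum_obj s : lmodType k := dsum (fun i => M i s).
Definition pm_dsum_map s t (h : s <= t) : {linear pm_dsum_obj s -> pm_dsum_obj t} :=
  dsum_map (fun i => pm_map (M i) h).

Fact pm_dsum_map_id s (h : s <= s) x : pm_dsum_map h x = x.
Proof. by apply/ffunP => i; rewrite dsum_mapE pm_map_id. Qed.

Fact pm_dsum_map_comp s t u (hst : s <= t) (htu : t <= u) (hsu : s <= u) x :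
  pm_dsum_map htu (pm_dsum_map hst x) = pm_dsum_map hsu x.
Proof. by apply/ffunP => i; rewrite !dsum_mapE (pm_map_comp hst htu hsu). Qed.

Definition pm_dsum : pmod R k := PMod pm_dsum_map_id pm_dsum_map_comp.

End DirectSum.

Definition nng_add s e : {nonneg R} := (s%:num + e%:num)%:nng.

Lemma nng_add_mono e s t : s <= t -> nng_add s e <= nng_add t e.
Proof. by move=> st; rewrite -num_le /= lerD2r. Qed.

Lemma le_nng_add2 e s : s <= nng_add (nng_add s e) e.
Proof. by rewrite -num_le /= -addrA lerDl addr_ge0. Qed.

Section Shift.
Variables (e : {nonneg R}) (M : pmod R k).

Definition pm_shift_map s t (h : s <= t) : {linear M (nng_add s e) -> M (nng_add t e)} :=
  pm_map M (nng_add_mono e h).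

Fact pm_shift_map_id s (h : s <= s) x : pm_shift_map h x = x.
Proof. exact: pm_map_id. Qed.

Fact pm_shift_map_comp s t u (hst : s <= t) (htu : t <= u) (hsu : s <= u) x :
  pm_shift_map htu (pm_shift_map hst x) = pm_shift_map hsu x.
Proof. exact: pm_map_comp. Qed.

Definition pm_shift : pmod R k := @PMod R k (fun s => M (nng_add s e))
  pm_shift_map pm_shift_map_id pm_shift_map_comp.

End Shift.

Record pm_hom M N := PMHom {
  pm_hom_fun :> forall s, {linear M s -> N s};
  pm_hom_natural : forall s t (h : s <= t) x,
    pm_hom_fun t (pm_map M h x) = pm_map N h (pm_hom_fun s x) }.

Definition pm_hom_shift e M N (f : pm_hom M N) :
    pm_hom (pm_shift e M) (pm_shift e N) :=
  @PMHom (pm_shift e M) (pm_shift e N) (fun s => f (nng_add s e))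
    (fun s t h => pm_hom_natural f (nng_add_mono e h)).

(* The two-fold shift of M has value M((s + e) + e) at s, and eta^{2e} is the
   structure map M(s) -> M((s + e) + e). *)
Definition interleaved e M N : Prop :=
  exists (f : pm_hom M (pm_shift e N)) (g : pm_hom N (pm_shift e M)),
    (forall s (y : N s),
       pm_hom_shift e f s (g s y) = pm_map N (le_nng_add2 e s) y) /\
    (forall s (x : M s),
       pm_hom_shift e g s (f s x) = pm_map M (le_nng_add2 e s) x).

Definition interleaving_distance M N : \bar R :=
  ereal_inf [set (e%:num)%:E | e in [set e | interleaved e M N]].

End PersistenceModules.

Record fpmspace (R : realType) := FPMSpace {
  fpm_point :> finType;
  fpm_dist : fpm_point -> fpm_point -> R;
  fpm_nonempty : (0 < #|fpm_point|)%N;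
  fpm_dist_ge0 : forall x y, 0 <= fpm_dist x y;
  fpm_distxx : forall x, fpm_dist x x = 0;
  fpm_distC : forall x y, fpm_dist x y = fpm_dist y x;
  fpm_dist_triangle : forall x y z,
    fpm_dist x z <= fpm_dist x y + fpm_dist y z }.

Section GromovHausdorff.
Variable R : realType.
Implicit Types X Y : fpmspace R.

Definition distortion X Y (th : X -> Y) : R :=
  \big[Order.max/0]_(p : X * X)
    `|fpm_dist p.1 p.2 - fpm_dist (th p.1) (th p.2)|.

(* The value is +oo if X and Y have different cardinalities. *)
Definition dGH' X Y : \bar R :=
  ((2^-1)%:E * \big[Order.min/+oo]_(th : {ffun X -> Y} | `[< bijective th >])
                 (distortion th)%:E)%E.

End GromovHausdorff.

Section PersistentHomology.
Variables (R : realType) (k : nzRingType) (X : fpmspace R).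
Implicit Types s t : {nonneg R}.

Definition rips t : scomplex X :=
  clique_complex [rel x y : X | fpm_dist x y <= t%:num].

Lemma rips_mono s t : s <= t -> faces (rips s) \subset faces (rips t).
Proof.
move=> st; apply/fintype.subsetP => a; rewrite !inE => /forall_inP aP.
apply/forall_inP => x xa; apply/forall_inP => y ya; apply/implyP => xy.
have /forall_inP/(_ y ya)/implyP/(_ xy) /= := aP x xa.
by move=> /le_trans; apply; rewrite num_le.
Qed.

Section Bidegree.
Variables i j : nat.

Definition PHZij_obj t : lmodType k := bihomology k (rips t) i j.
Definition PHZij_map s t (h : s <= t) : {linear PHZij_obj s -> PHZij_obj t} :=
  bihomology_map k i j (rips_mono h).

Fact PHZij_map_id s (h : s <= s) x : PHZij_map h x = x.
Proof. by apply/ffunP => J; rewrite dsum_mapE homology_map_id. Qed.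

Fact PHZij_map_comp s t u (hst : s <= t) (htu : t <= u) (hsu : s <= u) x :
  PHZij_map htu (PHZij_map hst x) = PHZij_map hsu x.
Proof.
by apply/ffunP => J; rewrite !dsum_mapE; exact: homology_map_comp.
Qed.

Definition PHZij : pmod R k := PMod PHZij_map_id PHZij_map_comp.

End Bidegree.

Definition PHZ : pmod R k :=
  pm_dsum (fun ij : 'I_#|X| * 'I_#|X|.+1 => PHZij ij.1 ij.2).

End PersistentHomology.

(* Main.v *)
(* A bijection of distortion e maps simplices of R(X, t) to simplices of
   R(Y, t + e), and its inverse maps R(Y, t) into R(X, t + e).  Both are
   bijective on vertices, so they match the full subcomplexes of the two
   Hochster decompositions and induce maps on bigraded homology.  They compose
   to the inclusions R(X, t) -> R(X, t + 2e), hence form an e-interleaving. *)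
Require Import Defs.
From HB Require Import structures.
From mathcomp Require Import all_boot all_order all_algebra.
From mathcomp Require Import all_classical all_reals.
From mathcomp Require Import ereal finset.

Set Implicit Arguments.
Unset Strict Implicit.
Unset Printing Implicit Defensive.

Import Order.TTheory GRing.Theory Num.Theory.
Local Open Scope ring_scope.

(** * Signs of vertex reorderings *)

Lemma vpos_sum (V : finType) (s : {set V}) v :
  vpos s v = (\sum_(u in s :\ v) (enum_rank u < enum_rank v))%N.
Proof.
rewrite /vpos -sum1_card big_mkcond [RHS]big_mkcond /=; apply: eq_bigr => u _.
rewrite !inE; have [->|_] := eqVneq u v; first by rewrite ltnn andbF.
by case: (u \in s) => //=; case: ltnP.
Qed.

Lemma imsetD1 (aT rT : finType) (f : aT -> rT) (A : {set aT}) x : injective f ->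
  f @: (A :\ x) = f @: A :\ f x.
Proof.
move=> f_inj; apply/setP => y; apply/imsetP/setD1P => [[z /setD1P[zx zA] ->]|].
  by rewrite (inj_eq f_inj) zx imset_f.
move=> [yx /imsetP[z zA yz]]; exists z => //.
by rewrite !inE zA -(inj_eq f_inj) -yz yx.
Qed.

Section Inversions.
Variables (V W : finType).
Implicit Types (f : V -> W) (s : {set V}).

(** For injective [f], the parity is that of the permutation sorting the images of the vertices of
    [s]. *)
Definition inversions f s : nat :=
  \sum_(u in s) \sum_(v in s)
    ((enum_rank u < enum_rank v) && (enum_rank (f v) < enum_rank (f u)))%N.

Lemma inversionsD1 f s v : v \in s ->
  inversions f s = (inversions f (s :\ v) + \sum_(u in s :\ v)
    (((enum_rank v < enum_rank u) && (enum_rank (f u) < enum_rank (f v))) +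
     ((enum_rank u < enum_rank v) && (enum_rank (f v) < enum_rank (f u)))))%N.
Proof.
move=> vs; rewrite /inversions (big_setD1 v)//= (big_setD1 v vs) /= ltnn add0n.
under [X in (_ + X)%N = _]eq_bigr do rewrite (big_setD1 v vs).
by rewrite !big_split /= addnA addnC.
Qed.

Lemma vpos_imset f s v : injective f ->
  vpos (f @: s) (f v) = (\sum_(u in s :\ v) (enum_rank (f u) < enum_rank (f v)))%N.
Proof.
move=> f_inj; rewrite vpos_sum -imsetD1//.
by rewrite big_imset//; exact: in2W.
Qed.

(** The number of inversions involving [v] has the parity of the difference between the position of
    [v] in [s] and that of [f v] in [f @: s]. This identity makes [push] commute with [bd]. *)
Lemma sign_vpos_imset (k : pzRingType) f s v : injective f -> v \in s ->
  (-1) ^+ vpos (f @: s) (f v) * (-1) ^+ inversions f s =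
  (-1) ^+ inversions f (s :\ v) * (-1) ^+ vpos s v :> k.
Proof.
move=> f_inj vs; rewrite -!exprD addnC (inversionsD1 f vs) -addnA.
rewrite vpos_imset// (vpos_sum s).
set a := (\sum_(u in _) (_ + _))%N; set b := (\sum_(u in _) _)%N.
set c := (\sum_(u in s :\ v) (enum_rank u < _))%N.
(* The equality holds for each [u] separately; the even excess counts the [u] after [v] whose image
   precedes [f v]. *)
suff -> : (a + b = c + (\sum_(u in s :\ v) ((enum_rank v < enum_rank u) &&
    (enum_rank (f u) < enum_rank (f v)))) * 2)%N.
  by rewrite addnA exprD [X in _ * X]exprM sqrr_sign mulr1.
rewrite /a /b /c big_distrl /= -!big_split /=; apply: eq_bigr => u.
rewrite !inE => /andP[uv _].
have : (enum_rank u == enum_rank v :> nat) = false.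
  by apply/eqP => /val_inj/enum_rank_inj/eqP; apply/negP.
have : (enum_rank (f u) == enum_rank (f v) :> nat) = false.
  by apply/eqP => /val_inj/enum_rank_inj/f_inj/eqP; apply/negP.
by case: (ltngtP (enum_rank (f u)) (enum_rank (f v))) => // _ _;
   case: (ltngtP (enum_rank u) (enum_rank v)).
Qed.

End Inversions.

(** A pair [(u, v)] is inverted by [g] exactly when [(g v, g u)] is inverted by [f]. *)
Lemma inversions_cancel (V W : finType) (f : V -> W) (g : W -> V) t :
  cancel g f -> inversions g t = inversions f (g @: t).
Proof.
move=> gK; rewrite /inversions exchange_big /=.
rewrite big_imset; last by apply: in2W; exact: can_inj gK.
apply: eq_bigr => u _; rewrite big_imset; last by apply: in2W; exact: can_inj gK.
by apply: eq_bigr => v _; rewrite !gK andbC.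
Qed.

(** * The chain map of a vertex bijection and its action on homology *)

Section Push.
Variables (k : nzRingType) (V W : finType) (f : V -> W).
Hypothesis f_bij : bijective f.
Implicit Types (K : scomplex V) (L : scomplex W) (c : {ffun {set V} -> k^o}).

(* The chain map induced by [f].  The sign is that of the reordering of the
   vertices of a face, as chains are oriented by [enum_rank]. *)
Definition push c : {ffun {set W} -> k^o} :=
  [ffun t : {set W} => (-1) ^+ inversions f (f @^-1: t) * c (f @^-1: t)].

Fact push_is_linear : linear push.
Proof.
move=> a c d; apply/ffunP => t; rewrite !ffunE mulrDr; congr (_ + _).
by rewrite /GRing.scale /= !mulrA commr_sign.
Qed.

HB.instance Definition _ :=
  GRing.isLinear.Build k _ _ *:%R push push_is_linear.

Let f_inj : injective f := bij_inj f_bij.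

Lemma imset_preimset (t : {set W}) : f @: (f @^-1: t) = t.
Proof.
have [g fK gK] := f_bij; by apply/setP => y; rewrite -[y]gK mem_imset// inE.
Qed.

Lemma preimset_imset (s : {set V}) : f @^-1: (f @: s) = s.
Proof. by apply/setP => x; rewrite inE mem_imset. Qed.

(** Once faces are reindexed by [s |-> f @: s] and vertices by [f], the two sums agree term by term,
    the signs by [sign_vpos_imset]. *)
Lemma bd_push c : bd (push c) = push (bd c).
Proof.
apply/ffunP => t; rewrite !ffunE.
have [g fK gK] := f_bij.
rewrite (reindex (fun s : {set V} => f @: s)) /=; last first.
  apply: onW_bij; exists (fun t : {set W} => f @^-1: t);
    [exact: preimset_imset|exact: imset_preimset].
rewrite mulr_sumr; apply: eq_bigr => s _.
rewrite (reindex f) /=; last exact: onW_bij.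
rewrite mulr_sumr; apply: eq_big => [v|v /andP[]].
  rewrite mem_imset//; case: (v \in s) => //=.
  rewrite -imsetD1//.
  by apply/eqP/eqP => [<-|->]; rewrite ?preimset_imset ?imset_preimset.
rewrite mem_imset// => vs /eqP <-.
rewrite ffunE -imsetD1//.
by rewrite !preimset_imset !mulrA sign_vpos_imset.
Qed.

Section Homology.
Variables (K : scomplex V) (L : scomplex W) (n : int).
Hypothesis fKL : forall s, s \in faces K -> f @: s \in faces L.

Lemma push_chain m c : c \in chain K m -> push c \in chain L m.
Proof.
move=> /chainP cK; apply/chainP => t; rewrite ffunE.
have [->|/cK[tK <-] _] := eqVneq (c (f @^-1: t)) 0; first by rewrite mulr0 eqxx.
by rewrite -{1 2}(imset_preimset t) fKL// card_imset.
Qed.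

Fact push_cycle (z : cycles k K n) : push (cycle_val z) \in cycle_pred L n.
Proof.
have /andP[zK /eqP z0] := valP z; apply/andP; split; first exact: push_chain.
by rewrite bd_push z0 raddf0.
Qed.

Definition cycle_push (z : cycles k K n) : cycles k L n := Cycle (push_cycle z).

Fact cycle_push_is_linear : linear cycle_push.
Proof. by move=> a y z; apply: val_inj; rewrite /= linearP. Qed.

HB.instance Definition _ :=
  GRing.isLinear.Build k _ _ *:%R cycle_push cycle_push_is_linear.

Fact cycle_push_boundaries z :
  z \in @boundaries k V K n -> cycle_push z \in @boundaries k W L n.
Proof.
move=> /asboolP[b bK bz]; apply/asboolP; exists (push b); first exact: push_chain.
by rewrite bd_push bz.
Qed.

Definition homology_push : {linear homology k K n -> homology k L n} :=
  quotmod_map cycle_push_boundaries.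

End Homology.
End Push.

Arguments homology_push {k V W f} f_bij {K L n} fKL.

(** Inclusions leave the underlying chain unchanged, so both sides push forward the same chain. *)
Lemma homology_push_natural (k : nzRingType) (V W : finType) (f : V -> W)
    (f_bij : bijective f) (K K' : scomplex V) (L L' : scomplex W) n
    (fKL : forall s, s \in faces K -> f @: s \in faces L)
    (fKL' : forall s, s \in faces K' -> f @: s \in faces L')
    (hK : faces K \subset faces K') (hL : faces L \subset faces L')
    (x : homology k K n) :
  homology_push f_bij fKL' (homology_map k n hK x) =
  homology_map k n hL (homology_push f_bij fKL x).
Proof.
rewrite -[x]quotmod_reprK; move: (quotmod_repr x) => z.
rewrite [homology_map k n hK _]quotmod_mapE [homology_push _ fKL _]quotmod_mapE.
by rewrite 2!quotmod_mapE; congr quotmod_pi; exact: val_inj.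
Qed.

(** On chains the round trip is the identity: by [inversions_cancel] the two signs are equal, so
    their product is 1. Only the ambient complex grows, from [K] to [K']. *)
Lemma homology_pushK (k : nzRingType) (V W : finType) (f : V -> W) (g : W -> V)
    (fK : cancel f g) (gK : cancel g f)
    (f_bij : bijective f) (g_bij : bijective g)
    (K K' : scomplex V) (L : scomplex W) n
    (fKL : forall s, s \in faces K -> f @: s \in faces L)
    (gLK' : forall s, s \in faces L -> g @: s \in faces K')
    (hK : faces K \subset faces K') (x : homology k K n) :
  homology_push g_bij gLK' (homology_push f_bij fKL x) = homology_map k n hK x.
Proof.
rewrite -[x]quotmod_reprK; move: (quotmod_repr x) => z.
rewrite [homology_push _ fKL _]quotmod_mapE 2!quotmod_mapE; congr quotmod_pi.
apply: val_inj; apply/ffunP => s /=; rewrite !ffunE.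
have -> : f @^-1: (g @^-1: s) = s by apply/setP => u; rewrite !inE fK.
by rewrite (inversions_cancel _ gK) imset_preimset// mulrA -expr2 sqrr_sign mul1r.
Qed.

(** * Reindexed direct sums and bigraded homology *)

Section Reindex.
Variables (k : nzRingType) (S T : finType) (r : S -> T).
Variables (M : T -> lmodType k) (N : S -> lmodType k).
Variable F : forall j, {linear M (r j) -> N j}.

(** Since the direct sum is encoded as a product, the index map runs from target to source: [r j] is
    the component feeding component [j]. *)
Definition dsum_reindex_fun (x : dsum M) : dsum N := [ffun j => F j (x (r j)) : N j].

Fact dsum_reindex_fun_is_linear : linear dsum_reindex_fun.
Proof.
move=> a x y; apply/ffunP => i.
by rewrite dsumDE dsumZE !ffunE linearP.
Qed.

Definition dsum_reindex : {linear dsum M -> dsum N} :=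
  HB.pack dsum_reindex_fun
    (GRing.isLinear.Build _ _ _ _ dsum_reindex_fun dsum_reindex_fun_is_linear).

Lemma dsum_reindexE x j : dsum_reindex x j = F j (x (r j)).
Proof. exact: ffunE. Qed.

End Reindex.

Lemma preimset_card_eq (V W : finType) (f : V -> W) (f_bij : bijective f) j
    (J : {J : {set W} | #|J| == j}) : #|f @^-1: val J| == j.
Proof.
by rewrite -(card_imset _ (bij_inj f_bij)) imset_preimset//; exact: (valP J).
Qed.

Definition preimset_sub (V W : finType) (f : V -> W) (f_bij : bijective f) j
    (J : {J : {set W} | #|J| == j}) : {J : {set V} | #|J| == j} :=
  Sub (f @^-1: val J) (preimset_card_eq f_bij J).

Lemma full_subcomplex_imset (V W : finType) (f : V -> W)
    (K : scomplex V) (L : scomplex W) (J : {set W}) :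
  (forall s, s \in faces K -> f @: s \in faces L) ->
  forall s, s \in faces (full_subcomplex K (f @^-1: J)) ->
    f @: s \in faces (full_subcomplex L J).
Proof.
by move=> fKL s; rewrite !inE => /andP[/fKL -> sJ]; rewrite sub_imset_pre.
Qed.

Section BigradedPush.
Variables (k : nzRingType) (V W : finType) (f : V -> W) (f_bij : bijective f).
Variables (i j : nat).

(** The Hochster summand of [J] is fed by that of its preimage, which has the same cardinality, so
    the bidegree is kept. *)
Definition bihomology_push (K : scomplex V) (L : scomplex W)
    (fKL : forall s, s \in faces K -> f @: s \in faces L) :
    {linear bihomology k K i j -> bihomology k L i j} :=
  dsum_reindex (fun J : {J : {set W} | #|J| == j} =>
    homology_push (K := full_subcomplex K (val (preimset_sub f_bij J)))
      (n := j%:Z - i%:Z - 1) f_bij (full_subcomplex_imset fKL)).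

Lemma bihomology_push_natural (K K' : scomplex V) (L L' : scomplex W)
    (fKL : forall s, s \in faces K -> f @: s \in faces L)
    (fKL' : forall s, s \in faces K' -> f @: s \in faces L')
    (hK : faces K \subset faces K') (hL : faces L \subset faces L') x :
  bihomology_push fKL' (bihomology_map k i j hK x) =
  bihomology_map k i j hL (bihomology_push fKL x).
Proof.
apply/ffunP => J; rewrite dsum_reindexE !dsum_mapE dsum_reindexE.
exact: homology_push_natural.
Qed.

End BigradedPush.

Arguments bihomology_push {k V W f} f_bij {i j K L} fKL.

(** For indices that are equal but not convertible, [x a] and [x b] have different types; they are
    compared after mapping both into a common complex [L]. *)
Lemma homology_map_dsum (k : nzRingType) (V : finType) (K : scomplex V)
    (I : finType) (J : I -> {set V}) n
    (x : dsum (fun a => homology k (full_subcomplex K (J a)) n))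
    (a b : I) (L : scomplex V)
    (ha : faces (full_subcomplex K (J a)) \subset faces L)
    (hb : faces (full_subcomplex K (J b)) \subset faces L) :
  a = b -> homology_map k n ha (x a) = homology_map k n hb (x b).
Proof. by move=> ab; case: b / ab hb => hb; rewrite (bool_irrelevance ha hb). Qed.

Lemma bihomology_pushK (k : nzRingType) (V W : finType) (f : V -> W) (g : W -> V)
    (fK : cancel f g) (gK : cancel g f)
    (f_bij : bijective f) (g_bij : bijective g) i j
    (K K' : scomplex V) (L : scomplex W)
    (fKL : forall s, s \in faces K -> f @: s \in faces L)
    (gLK' : forall s, s \in faces L -> g @: s \in faces K')
    (hK : faces K \subset faces K') (x : bihomology k K i j) :
  bihomology_push g_bij gLK' (bihomology_push f_bij fKL x) =
  bihomology_map k i j hK x.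
Proof.
apply/ffunP => J; rewrite dsum_reindexE dsum_mapE.
rewrite [X in homology_push _ _ X]dsum_reindexE.
have JE : preimset_sub f_bij (preimset_sub g_bij J) = J.
  by apply: val_inj; apply/setP => u; rewrite !inE fK.
(* The double preimage of [J] is equal but not convertible to [J], so the round trip first yields
   the inclusion from the full subcomplex on the double preimage. *)
have h : faces (full_subcomplex K (val (preimset_sub f_bij (preimset_sub g_bij J))))
    \subset faces (full_subcomplex K' (val J)).
  by rewrite JE full_subcomplex_mono.
rewrite (homology_pushK fK gK _ _ _ _ h).
exact: homology_map_dsum.
Qed.

(* For [A] the type of bidegrees, this identifies the components of [x] at two
   indices whose bidegrees are convertible. *)
Lemma dependent_transport (I : Type) (A : eqType) (d : I -> A) (P : A -> Type)
    (x : forall a, P (d a)) a b (ab : a = b) (dab : d a = d b) :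
  eq_rect (d a) P (x a) (d b) dab = x b.
Proof. by case: b / ab dab => dab; rewrite eq_axiomK. Qed.

(** * The interleaving given by a bijection of bounded distortion *)

Section PersistentPush.
Variables (R : realType) (k : nzRingType).

Section Hom.
Variables (X Y : fpmspace R) (e : {nonneg R}) (f : X -> Y).
Hypotheses (f_bij : bijective f) (XY : #|Y| = #|X|).
Hypothesis f_lip : forall x y,
  fpm_dist (f x) (f y) <= fpm_dist x y + e%:num.

Lemma rips_imset (t : {nonneg R}) s : s \in faces (rips X t) ->
  f @: s \in faces (rips Y (nng_add t e)).
Proof.
rewrite !inE => /forall_inP sP.
apply/forall_inP => _ /imsetP[x xs ->]; apply/forall_inP => _ /imsetP[y ys ->].
apply/implyP; rewrite (inj_eq (bij_inj f_bij)) => xy.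
have /forall_inP/(_ y ys)/implyP/(_ xy) /= xyt := sP x xs.
by rewrite (le_trans (f_lip x y))// lerD2r.
Qed.

(** The type of bidegrees depends on the cardinality. The cast keeps the underlying numbers, so the
    summands it matches have convertible bidegrees and need no transport. *)
Definition bidegree_cast (ij : 'I_#|Y| * 'I_#|Y|.+1) : 'I_#|X| * 'I_#|X|.+1 :=
  (cast_ord XY ij.1, cast_ord (congr1 S XY) ij.2).

Definition PHZ_push_map t : {linear PHZ k X t -> PHZ k Y (nng_add t e)} :=
  @dsum_reindex k _ _ bidegree_cast
    (fun ij => PHZij k X ij.1 ij.2 t)
    (fun ij => PHZij k Y ij.1 ij.2 (nng_add t e))
    (fun ij => bihomology_push f_bij (@rips_imset t)).

Fact PHZ_push_natural s t (h : s <= t) x :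
  PHZ_push_map t (pm_map (PHZ k X) h x) =
  pm_map (pm_shift e (PHZ k Y)) h (PHZ_push_map s x).
Proof.
apply/ffunP => ij; rewrite dsum_reindexE !dsum_mapE dsum_reindexE.
exact: bihomology_push_natural.
Qed.

Definition PHZ_push : pm_hom (PHZ k X) (pm_shift e (PHZ k Y)) :=
  @PMHom R k (PHZ k X) (pm_shift e (PHZ k Y)) PHZ_push_map PHZ_push_natural.

End Hom.

Lemma PHZ_pushK (X Y : fpmspace R) (e : {nonneg R}) (f : X -> Y) (g : Y -> X)
    (fK : cancel f g) (gK : cancel g f)
    (f_bij : bijective f) (g_bij : bijective g)
    (YX : #|Y| = #|X|) (XY : #|X| = #|Y|)
    (f_lip : forall x y, fpm_dist (f x) (f y) <= fpm_dist x y + e%:num)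
    (g_lip : forall x y, fpm_dist (g x) (g y) <= fpm_dist x y + e%:num)
    s (x : PHZ k X s) :
  pm_hom_shift e (PHZ_push g_bij XY g_lip) s (PHZ_push f_bij YX f_lip s x) =
  pm_map (PHZ k X) (le_nng_add2 e s) x.
Proof.
apply/ffunP => ij; rewrite dsum_mapE [LHS]dsum_reindexE.
rewrite [X in bihomology_push _ _ X]dsum_reindexE.
rewrite (bihomology_pushK fK gK _ _ _ _ (rips_mono X (le_nng_add2 e s))).
congr (bihomology_map _ _ _ _ _).
have ijE : bidegree_cast YX (bidegree_cast XY ij) = ij.
  by case: ij => i j; congr (_, _); exact: val_inj.
(* The double cast of [ij] has the same underlying numbers as [ij] by computation, so [erefl] serves
   and the transport along it reduces away. *)
exact: (@dependent_transport _ (nat * nat)%type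
  (fun ij : 'I_#|X| * 'I_#|X|.+1 => (ij.1 : nat, ij.2 : nat))
  (fun d => bihomology k (rips X s) d.1 d.2) x _ _ ijE erefl).
Qed.

(** The absolute bound gives a one-sided bound for [f] and one for its inverse, hence the two
    morphisms. The two identities are one lemma with the roles of [X] and [Y] exchanged. *)
Lemma interleaved_PHZ (X Y : fpmspace R) (e : {nonneg R}) (f : X -> Y) :
  bijective f ->
  (forall x y, `|fpm_dist x y - fpm_dist (f x) (f y)| <= e%:num) ->
  interleaved e (PHZ k X) (PHZ k Y).
Proof.
move=> f_bij f_dist; have [g fK gK] := f_bij.
have g_bij : bijective g by exists f.
have XY := bij_eq_card f_bij; have YX := esym XY.
have f_lip x y : fpm_dist (f x) (f y) <= fpm_dist x y + e%:num.
  by apply: ler_distlDr; rewrite distrC.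
have g_lip x y : fpm_dist (g x) (g y) <= fpm_dist x y + e%:num.
  by apply: ler_distlDr; have := f_dist (g x) (g y); rewrite !gK.
exists (PHZ_push f_bij YX f_lip), (PHZ_push g_bij XY g_lip).
by split=> s x; exact: PHZ_pushK.
Qed.

End PersistentPush.

Theorem theorem4p21 (R : realType) (k : idomainType) (hk : is_pid k)
    (X Y : fpmspace R) (hXY : #|X| = #|Y|) :
  (interleaving_distance (PHZ k X) (PHZ k Y) <= 2%:E * dGH' X Y)%E.
Proof.
(* The factors 2 and 1/2 cancel. It remains to bound the distance by the default [+oo] of the
   minimum and by the distortion of each bijection. *)
rewrite /dGH' muleA -EFinM mulfV ?pnatr_eq0// mul1e.
apply: le_bigmin => [|th /asboolP th_bij]; first exact: leey.
(* The maximum starts from the default 0, so the distortion is a valid interleaving parameter. *)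
have dist_ge0 : 0 <= distortion th by exact: bigmax_ge_id.
apply: ereal_inf_lbound; exists (NngNum dist_ge0) => //=.
apply: interleaved_PHZ th_bij _ => x y.
exact: (le_bigmax _ _ (x, y)).
Qed.
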